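(* Let $A$ be a finite-dimensional unimodular Hopf algebra over a field $k$, and let $\lambda$ be a non-zero left integral in $A^*$. Regard $A=(A,\triangleright,\Delta)$ as an object of the category ${}_A^A\mathcal{YD}$ of Yetter--Drinfeld modules over $A$ via the conjugate action $a\triangleright b=a_{(1)}bS(a_{(2)})$ and the coproduct $\Delta$. Define linear maps $\mathrm{ev}_A:A\otimes A\to k$, $\mathrm{ev}_A(a\otimes b)=\lambda(ab)$, and $\mathrm{coev}_A:k\to A\otimes A$, $\mathrm{coev}_A(1)=U_\lambda$. (1) $\mathrm{ev}_A$ and $\mathrm{coev}_A$ are both morphisms in ${}_A^A\mathcal{YD}$. (2) The object $A=(A,\triangleright,\Delta)$ in ${}_A^A\mathcal{YD}$, equipped with its product $m_A$ and with $\mathrm{ev}_A$, $\mathrm{coev}_A$, is a quantum-commutative quantum-symmetric algebra in ${}_A^A\mathcal{YD}$.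
   Context: Sweedler notation $\Delta(a)=a_{(1)}\otimes a_{(2)}$; $\varepsilon$ is the counit, $S$ the antipode. A left (resp. right) integral in $A$ is $\Lambda\in A$ with $a\Lambda=\varepsilon(a)\Lambda$ (resp. $\Lambda a=\varepsilon(a)\Lambda$) for all $a\in A$; similarly for the dual Hopf algebra $A^*$. $A$ is unimodular if its left integrals and right integrals coincide. $U_\lambda=\sum_i\beta_i\otimes\alpha_i$, where $(\alpha_i)$, $(\beta_i)$ are bases of $A$ dual to each other with respect to the non-degenerate form $\langle a,b\rangle_\lambda=\lambda(ab)$, i.e. $\lambda(\alpha_i\beta_j)=\delta_{ij}$. ${}_A^A\mathcal{YD}$ is the braided tensor category of left $A$-modules $V$ with a left $A$-comodule structure $\rho(v)=v_{(-1)}\otimes v_{(0)}\in A\otimes V$ satisfying $\rho(av)=a_{(1)}v_{(-1)}S(a_{(3)})\otimes a_{(2)}v_{(0)}$; morphisms are $A$-linear and $A$-colinear maps; tensor product over $k$, unit $k$ and constraints are the usual ones; the braiding is $c_{V,W}(v\otimes w)=v_{(-1)}w\otimes v_{(0)}$. A quantum-commutative quantum-symmetric algebra in a braided tensor category $(\mathcal{B},\otimes,I)$ with braiding $c$ is a (not necessarily unital) associative algebra $A$ in $\mathcal{B}$, with multiplication $m_A:A\otimes A\to A$, equipped with morphisms $\mathrm{ev}_A:A\otimes A\to I$ and $\mathrm{coev}_A:I\to A\otimes A$ such that (constraints suppressed): $(\mathrm{ev}_A\otimes\mathrm{id}_A)\circ(\mathrm{id}_A\otimes\mathrm{coev}_A)=\mathrm{id}_A=(\mathrm{id}_A\otimes\mathrm{ev}_A)\circ(\mathrm{coev}_A\otimes\mathrm{id}_A)$;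 $\mathrm{ev}_A\circ(m_A\otimes\mathrm{id}_A)=\mathrm{ev}_A\circ(\mathrm{id}_A\otimes m_A)$; $m_A\circ c_{A,A}=m_A$; $\mathrm{ev}_A\circ c_{A,A}=\mathrm{ev}_A$. *)

(* Defs.v *)
(* MathComp, with classical reasoning from mathcomp-classical. *)
From HB Require Import structures.
From mathcomp Require Import all_boot all_order all_algebra all_field.
From mathcomp Require Import boolp.

Set Implicit Arguments.
Unset Strict Implicit.
Unset Printing Implicit Defensive.

Import GRing.Theory.
Local Open Scope ring_scope.
Local Open Scope quotient_scope.

(* The tensor product of two (possibly infinite-dimensional) vector spaces is
   the set of finite families of pairs (v, w), read as sums of v \ox w, modulo
   the relation "every bilinear map takes the same value on both".  The
   universal property is proved below (swE, sum_sw_linear, sum_sw_pure).      *)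
Section TensorRelation.
Variables (k : fieldType) (V W : lmodType k).

Definition tensor_rel : rel (seq (V * W)) := fun s t =>
  `[< forall (U : lmodType k) (f : {bilinear V -> W -> U}),
        \sum_(p <- s) f p.1 p.2 = \sum_(p <- t) f p.1 p.2 >].

Lemma tensor_rel_refl : reflexive tensor_rel.
Proof. by move=> s; apply/asboolP. Qed.

Lemma tensor_rel_sym : symmetric tensor_rel.
Proof. by move=> s t; apply/asboolP/asboolP => h U f; rewrite h. Qed.

Lemma tensor_rel_trans : transitive tensor_rel.
Proof.
move=> t s r /asboolP h1 /asboolP h2; apply/asboolP => U f.
by rewrite h1 h2.
Qed.

Canonical tensor_equiv :=
  EquivRel tensor_rel tensor_rel_refl tensor_rel_sym tensor_rel_trans.

Definition tensor : Type := {eq_quot tensor_equiv}.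

HB.instance Definition _ := Choice.on tensor.
HB.instance Definition _ := Quotient.on tensor.
HB.instance Definition _ : EqQuotient _ tensor_equiv tensor :=
  EqQuotient.on tensor.

(* Sweedler notation: for t : tensor V W, sw t is a list of pairs such that
   t is the sum of the p.1 \ox p.2 with p in sw t.  The list is a choice, but
   \sum_(p <- sw t) f p.1 p.2 does not depend on it as soon as f is bilinear. *)
Definition sw (t : tensor) : seq (V * W) := repr t.

Definition pure (v : V) (w : W) : tensor := \pi_tensor [:: (v, w)].

Lemma tensor_eqP (s t : seq (V * W)) :
  (forall (U : lmodType k) (f : {bilinear V -> W -> U}),
     \sum_(p <- s) f p.1 p.2 = \sum_(p <- t) f p.1 p.2) <->
  \pi_tensor s = \pi_tensor t.
Proof.
split=> [h|/eqmodP/asboolP//].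
by apply/eqmodP/asboolP.
Qed.

Lemma sw_pi (s : seq (V * W)) (U : lmodType k) (f : {bilinear V -> W -> U}) :
  \sum_(p <- sw (\pi_tensor s)) f p.1 p.2 = \sum_(p <- s) f p.1 p.2.
Proof. by move: U f; apply/tensor_eqP; rewrite reprK. Qed.

Definition tensor_zero : tensor := \pi_tensor [::].
Definition tensor_add (s t : tensor) : tensor := \pi_tensor (sw s ++ sw t).
Definition tensor_scale (c : k) (t : tensor) : tensor :=
  \pi_tensor [seq (c *: p.1, p.2) | p <- sw t].
Definition tensor_opp (t : tensor) : tensor := tensor_scale (-1) t.

Lemma tensor_ext (s t : tensor) :
  (forall (U : lmodType k) (f : {bilinear V -> W -> U}),
     \sum_(p <- sw s) f p.1 p.2 = \sum_(p <- sw t) f p.1 p.2) -> s = t.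
Proof. by move/tensor_eqP; rewrite !reprK. Qed.

Lemma sw_scale c t (U : lmodType k) (f : {bilinear V -> W -> U}) :
  \sum_(p <- sw (tensor_scale c t)) f p.1 p.2 =
  c *: \sum_(p <- sw t) f p.1 p.2.
Proof.
rewrite sw_pi big_map scaler_sumr; apply: eq_bigr => p _ /=.
by rewrite linearZl_LR.
Qed.

Lemma sw_add s t (U : lmodType k) (f : {bilinear V -> W -> U}) :
  \sum_(p <- sw (tensor_add s t)) f p.1 p.2 =
  \sum_(p <- sw s) f p.1 p.2 + \sum_(p <- sw t) f p.1 p.2.
Proof. by rewrite sw_pi big_cat. Qed.

Lemma sw_zero (U : lmodType k) (f : {bilinear V -> W -> U}) :
  \sum_(p <- sw tensor_zero) f p.1 p.2 = 0.
Proof. by rewrite sw_pi big_nil. Qed.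

Lemma tensor_addA : associative tensor_add.
Proof. by move=> r s t; apply: tensor_ext => U f; rewrite !sw_add addrA. Qed.

Lemma tensor_addC : commutative tensor_add.
Proof. by move=> s t; apply: tensor_ext => U f; rewrite !sw_add addrC. Qed.

Lemma tensor_add0 : left_id tensor_zero tensor_add.
Proof. by move=> t; apply: tensor_ext => U f; rewrite sw_add sw_zero add0r. Qed.

Lemma tensor_addN : left_inverse tensor_zero tensor_opp tensor_add.
Proof.
move=> t; apply: tensor_ext => U f.
by rewrite sw_add sw_scale sw_zero scaleN1r addNr.
Qed.

HB.instance Definition _ := GRing.isZmodule.Build tensor
  tensor_addA tensor_addC tensor_add0 tensor_addN.

Lemma tensor_scaleA a b t :
  tensor_scale a (tensor_scale b t) = tensor_scale (a * b) t.
Proof. by apply: tensor_ext => U f; rewrite !sw_scale scalerA. Qed.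

Lemma tensor_scale1 : left_id 1 tensor_scale.
Proof. by move=> t; apply: tensor_ext => U f; rewrite sw_scale scale1r. Qed.

Lemma tensor_scaleDr : right_distributive tensor_scale +%R.
Proof.
move=> a s t; apply: tensor_ext => U f.
by rewrite !(sw_scale, sw_add) scalerDr.
Qed.

Lemma tensor_scaleDl t : {morph tensor_scale^~ t : a b / a + b}.
Proof.
move=> a b; apply: tensor_ext => U f.
by rewrite !(sw_scale, sw_add) scalerDl.
Qed.

HB.instance Definition _ := GRing.Zmodule_isLmodule.Build k tensor
  tensor_scaleA tensor_scale1 tensor_scaleDr tensor_scaleDl.

Lemma pure_is_bilinear : bilinear_for *:%R *:%R pure.
Proof.
by split=> [w a v v'|v a w w']; apply: tensor_ext => U f;
  rewrite sw_add sw_scale !sw_pi !big_seq1 /= ?linearPl ?linearPr.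
Qed.

Lemma sum_sw_linear (U : lmodType k) (f : V -> W -> U) :
  bilinear_for *:%R *:%R f ->
  linear (fun t : tensor => \sum_(p <- sw t) f p.1 p.2).
Proof.
move=> fP a s t.
pose g : {bilinear V -> W -> U} :=
  HB.pack f (@bilinear_isBilinear.Build k V W U *:%R *:%R f fP).
by rewrite -[f]/(g : V -> W -> U) sw_add sw_scale.
Qed.

Lemma sum_sw_pure (U : lmodType k) (f : V -> W -> U) v w :
  bilinear_for *:%R *:%R f ->
  \sum_(p <- sw (pure v w)) f p.1 p.2 = f v w.
Proof.
move=> fP.
pose g : {bilinear V -> W -> U} :=
  HB.pack f (@bilinear_isBilinear.Build k V W U *:%R *:%R f fP).
by rewrite -[f]/(g : V -> W -> U) sw_pi big_seq1.
Qed.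

End TensorRelation.

HB.instance Definition _ (k : fieldType) (V W : lmodType k) :=
  bilinear_isBilinear.Build k V W (tensor V W) *:%R *:%R (@pure k V W)
    (@pure_is_bilinear k V W).

Notation "v \ox w" := (pure v w) (at level 40, left associativity) : ring_scope.

Lemma swE (k : fieldType) (V W : lmodType k) (t : tensor V W) :
  t = \sum_(p <- sw t) p.1 \ox p.2.
Proof.
apply: tensor_ext => U f.
pose F (s : tensor V W) := \sum_(p <- sw s) f p.1 p.2.
have F0 : F 0 = 0 by exact: sw_zero.
have FD : {morph F : x y / x + y} by move=> x y; exact: sw_add.
rewrite -[RHS]/(F _) (big_morph F FD F0); apply: eq_bigr => p _.
by rewrite /F sw_pi big_seq1.
Qed.

Section TensorMaps.
Variable k : fieldType.

Definition tmap (V V' W W' : lmodType k) (f : V -> V') (g : W -> W')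
    (t : tensor V W) : tensor V' W' :=
  \sum_(p <- sw t) f p.1 \ox g p.2.

Definition tassoc (U V W : lmodType k) (t : tensor (tensor U V) W) :
    tensor U (tensor V W) :=
  \sum_(p <- sw t) \sum_(q <- sw p.1) q.1 \ox (q.2 \ox p.2).

Definition tassoc_inv (U V W : lmodType k) (t : tensor U (tensor V W)) :
    tensor (tensor U V) W :=
  \sum_(p <- sw t) \sum_(q <- sw p.2) (p.1 \ox q.1) \ox q.2.

Definition tlunit (V : lmodType k) (t : tensor (k^o : lmodType k) V) : V :=
  \sum_(p <- sw t) (p.1 : k) *: p.2.

Definition trunit (V : lmodType k) (t : tensor V (k^o : lmodType k)) : V :=
  \sum_(p <- sw t) (p.2 : k) *: p.1.

End TensorMaps.

(* falgType k: unital associative algebras of finite dimension over k. *)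
Record hopfAlg (k : fieldType) := HopfAlg {
  hopf_alg :> falgType k;
  coprod : {linear hopf_alg -> tensor hopf_alg hopf_alg};
  counit : {scalar hopf_alg};
  antipode : {linear hopf_alg -> hopf_alg};
  coprodA : forall a : hopf_alg,
    \sum_(p <- sw (coprod a)) \sum_(q <- sw (coprod p.1))
       q.1 \ox (q.2 \ox p.2) =
    \sum_(p <- sw (coprod a)) \sum_(q <- sw (coprod p.2))
       p.1 \ox (q.1 \ox q.2);
  counitl : forall a : hopf_alg,
    \sum_(p <- sw (coprod a)) counit p.1 *: p.2 = a;
  counitr : forall a : hopf_alg,
    \sum_(p <- sw (coprod a)) counit p.2 *: p.1 = a;
  coprod1 : coprod 1 = 1 \ox 1;
  coprodM : forall a b : hopf_alg,
    coprod (a * b) =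
    \sum_(p <- sw (coprod a)) \sum_(q <- sw (coprod b))
       (p.1 * q.1) \ox (p.2 * q.2);
  counit1 : counit 1 = 1;
  counitM : forall a b : hopf_alg, counit (a * b) = counit a * counit b;
  antipodel : forall a : hopf_alg,
    \sum_(p <- sw (coprod a)) antipode p.1 * p.2 = counit a *: 1;
  antipoder : forall a : hopf_alg,
    \sum_(p <- sw (coprod a)) p.1 * antipode p.2 = counit a *: 1
}.

Arguments coprod {k h}.
Arguments counit {k h}.
Arguments antipode {k h}.

Section Integrals.
Variables (k : fieldType) (A : hopfAlg k).

Definition left_integral (L : A) := forall a : A, a * L = counit a *: L.
Definition right_integral (L : A) := forall a : A, L * a = counit a *: L.

Definition unimodular := forall L : A, left_integral L <-> right_integral L.

(* The product and the counit of the dual Hopf algebra. *)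
Definition dual_mul (f g : A -> k) (a : A) : k :=
  \sum_(p <- sw (coprod a)) f p.1 * g p.2.
Definition dual_counit (f : A -> k) : k := f 1.

Definition dual_left_integral (lam : {scalar A}) :=
  forall (f : {scalar A}) (a : A), dual_mul f lam a = dual_counit f * lam a.

End Integrals.

(* The element U_lam = \sum_i beta_i \ox alpha_i, with alpha the library's
   basis of A and beta its dual basis, obtained by inverting the Gram matrix
   of the form (a, b) |-> lam (a * b).  The lemma can_elemE shows that every
   pair of dual bases gives this same element, and can_dual_bases that alpha
   and beta are indeed dual bases as soon as the form is non-degenerate.      *)
Section CanonicalElement.
Variables (k : fieldType) (A : falgType k) (lam : {scalar A}).

Definition dual_bases (n : nat) (alpha beta : n.-tuple A) :=
  [/\ basis_of fullv alpha, basis_of fullv beta &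
      forall i j : 'I_n, lam (alpha`_i * beta`_j) = (i == j)%:R].

Let d := \dim {:A}.

Definition can_alpha (i : 'I_d) : A := (vbasis {:A})`_i.

Definition gram : 'M[k]_d :=
  \matrix_(i, j) lam (can_alpha i * can_alpha j).

Definition can_beta (j : 'I_d) : A :=
  \sum_i invmx gram i j *: can_alpha i.

Definition can_elem : tensor A A := \sum_i can_beta i \ox can_alpha i.

Lemma can_alpha_expand (a : A) :
  a = \sum_i coord (vbasis {:A}) i a *: can_alpha i.
Proof. exact: (coord_vbasis (memvf a)). Qed.

Lemma can_pairing : gram \in unitmx ->
  forall i j, lam (can_alpha i * can_beta j) = (i == j)%:R.
Proof.
move=> gU i j; have /matrixP/(_ i j) := mulmxV gU; rewrite !mxE => <-.
rewrite mulr_sumr linear_sum; apply: eq_bigr => l _.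
by rewrite -scalerAr linearZ_LR mxE mulrC.
Qed.

Lemma nondegenerate_gram :
  (forall a, (forall b, lam (b * a) = 0) -> a = 0) -> gram \in unitmx.
Proof.
move=> nd; rewrite -unitmx_tr -row_free_unit -kermx_eq0.
apply/eqP/row_matrixP => i; rewrite row0.
set v := row i _.
have hv : v *m gram^T = 0 by rewrite /v -row_mul mulmx_ker row0.
pose a := \sum_j v 0 j *: can_alpha j.
have a0 : a = 0.
  apply: nd => b; rewrite [b]can_alpha_expand mulr_suml linear_sum big1 // => l _.
  rewrite -scalerAl linearZ_LR /=.
  suff -> : lam (can_alpha l * a) = 0 by rewrite mulr0.
  have /matrixP/(_ 0 l) := hv; rewrite !mxE => <-.
  rewrite mulr_sumr linear_sum; apply: eq_bigr => j _.
  by rewrite -scalerAr linearZ_LR !mxE.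
apply/rowP => j; rewrite [RHS]mxE.
have /freeP/(_ (fun j => v 0 j) a0) := basis_free (vbasisP {:A}).
exact.
Qed.

Lemma can_elemE (n : nat) (alpha beta : n.-tuple A) :
  dual_bases alpha beta ->
  can_elem = \sum_(i < n) beta`_i \ox alpha`_i.
Proof.
move=> [aB bB ab].
have expa (a : A) : a = \sum_(i < n) lam (a * beta`_i) *: alpha`_i.
  rewrite {1}(coord_basis aB (memvf a)); apply: eq_bigr => i _; congr (_ *: _).
  rewrite {2}(coord_basis aB (memvf a)) mulr_suml linear_sum (bigD1 i) //= .
  rewrite -scalerAl linearZ_LR /= ab eqxx mulr1 big1 ?addr0 // => j ji.
  by rewrite -scalerAl linearZ_LR /= ab (negPf ji) mulr0.
have expb (a : A) : a = \sum_(i < n) lam (alpha`_i * a) *: beta`_i.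
  rewrite {1}(coord_basis bB (memvf a)); apply: eq_bigr => i _; congr (_ *: _).
  rewrite {2}(coord_basis bB (memvf a)) mulr_sumr linear_sum (bigD1 i) //= .
  rewrite -scalerAr linearZ_LR /= ab eqxx mulr1 big1 ?addr0 // => j ji.
  by rewrite -scalerAr linearZ_LR /= ab eq_sym (negPf ji) mulr0.
have gU : gram \in unitmx.
  apply: nondegenerate_gram => a ha.
  by rewrite [a]expb big1 // => i _; rewrite ha scale0r.
have cexp (a : A) : a = \sum_i lam (a * can_beta i) *: can_alpha i.
  rewrite {1}[a]can_alpha_expand; apply: eq_bigr => i _; congr (_ *: _).
  rewrite {2}[a]can_alpha_expand mulr_suml linear_sum (bigD1 i) //= .
  rewrite -scalerAl linearZ_LR /= can_pairing // eqxx mulr1 big1 ?addr0 // => j ji.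
  by rewrite -scalerAl linearZ_LR /= can_pairing // (negPf ji) mulr0.
rewrite /can_elem.
transitivity (\sum_i \sum_(j < n)
    beta`_j \ox (lam (alpha`_j * can_beta i) *: can_alpha i)).
  apply: eq_bigr => i _; rewrite {1}[can_beta i]expb linear_sumlz.
  by apply: eq_bigr => j _; rewrite linearZl_LR linearZr_LR.
rewrite exchange_big; apply: eq_bigr => j _ /=.
by rewrite -linear_sumr -cexp.
Qed.

Lemma can_dual_bases :
  (forall a, (forall b, lam (b * a) = 0) -> a = 0) ->
  dual_bases (vbasis {:A}) [tuple can_beta i | i < d].
Proof.
move=> nd; have gU := nondegenerate_gram nd.
have nthb (i : 'I_d) : [tuple can_beta i | i < d]`_i = can_beta i.
  by rewrite -tnth_nth tnth_mktuple.
split; first exact: vbasisP.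
- rewrite basisEfree subvf size_tuple leqnn !andbT.
  apply/freeP => c /(congr1 (fun b => fun i => lam (can_alpha i * b))) h i.
  have := congr1 (fun f => f i) h; rewrite mulr0 linear0 mulr_sumr linear_sum.
  rewrite (bigD1 i) //= nthb -scalerAr linearZ_LR /= can_pairing // eqxx mulr1.
  rewrite big1 ?addr0 // => j ji.
  by rewrite nthb -scalerAr linearZ_LR /= can_pairing // eq_sym (negPf ji) mulr0.
- by move=> i j; rewrite nthb; apply: can_pairing.
Qed.

End CanonicalElement.

Section YetterDrinfeld.
Variables (k : fieldType) (A : hopfAlg k).

Record ydData := YDData {
  yd_car :> lmodType k;
  yd_act : A -> yd_car -> yd_car;
  yd_coact : yd_car -> tensor A yd_car
}.

Record is_yd (X : ydData) : Prop := IsYD {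
  yd_act_bilinear : bilinear_for *:%R *:%R (@yd_act X);
  yd_act1 : forall x : X, yd_act 1 x = x;
  yd_actM : forall (a b : A) (x : X),
    yd_act (a * b) x = yd_act a (yd_act b x);
  yd_coact_linear : linear (@yd_coact X);
  yd_coactA : forall x : X,
    \sum_(p <- sw (yd_coact x)) \sum_(q <- sw (coprod p.1))
       q.1 \ox (q.2 \ox p.2) =
    \sum_(p <- sw (yd_coact x)) \sum_(q <- sw (yd_coact p.2))
       p.1 \ox (q.1 \ox q.2);
  yd_coact_counit : forall x : X,
    \sum_(p <- sw (yd_coact x)) counit p.1 *: p.2 = x;
  (* p ~ a_(12) \ox a_(3), q ~ a_(1) \ox a_(2), r ~ x_(-1) \ox x_(0) *)
  yd_compat : forall (a : A) (x : X),
    yd_coact (yd_act a x) =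
    \sum_(p <- sw (coprod a)) \sum_(q <- sw (coprod p.1))
       \sum_(r <- sw (yd_coact x))
          (q.1 * r.1 * antipode p.2) \ox yd_act q.2 r.2
}.

Definition yd_morphism (X Y : ydData) (f : X -> Y) : Prop :=
  [/\ linear f,
      forall (a : A) (x : X), f (yd_act a x) = yd_act a (f x) &
      forall x : X, yd_coact (f x) = tmap id f (yd_coact x)].

Definition yd_unit : ydData :=
  @YDData (k^o : lmodType k) (fun a c => counit a * c) (fun c => 1 \ox c).

(* a (x \ox y) = a_(1) x \ox a_(2) y  and
   rho (x \ox y) = x_(-1) y_(-1) \ox (x_(0) \ox y_(0)). *)
Definition yd_tensor (X Y : ydData) : ydData :=
  @YDData (tensor X Y)
    (fun a t => \sum_(p <- sw (coprod a)) \sum_(q <- sw t)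
       yd_act p.1 q.1 \ox yd_act p.2 q.2)
    (fun t => \sum_(q <- sw t)
       \sum_(r <- sw (yd_coact q.1)) \sum_(s <- sw (yd_coact q.2))
          (r.1 * s.1) \ox (r.2 \ox s.2)).

Definition yd_braiding (X Y : ydData) (t : yd_tensor X Y) : yd_tensor Y X :=
  \sum_(q <- sw t) \sum_(r <- sw (yd_coact q.1)) yd_act r.1 q.2 \ox r.2.

Record is_qcqs_algebra (X : ydData) (m : yd_tensor X X -> X)
    (ev : yd_tensor X X -> yd_unit) (coev : yd_unit -> yd_tensor X X) :
    Prop := IsQCQSAlgebra {
  qcqs_object : is_yd X;
  qcqs_mul : yd_morphism m;
  qcqs_assoc : forall t : yd_tensor (yd_tensor X X) X,
    m (tmap m id t) = m (tmap id m (tassoc t));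
  qcqs_ev : yd_morphism ev;
  qcqs_coev : yd_morphism coev;
  (* The two zigzag identities, with x \ox 1 and 1 \ox x for the inverse unit
     constraints. *)
  qcqs_zigzagl : forall x : X,
    tlunit (tmap ev id (tassoc_inv (tmap id coev (x \ox (1 : k^o))))) = x;
  qcqs_zigzagr : forall x : X,
    trunit (tmap id ev (tassoc (tmap coev id ((1 : k^o) \ox x)))) = x;
  qcqs_invariant : forall t : yd_tensor (yd_tensor X X) X,
    ev (tmap m id t) = ev (tmap id m (tassoc t));
  qcqs_mul_comm : forall t : yd_tensor X X, m (yd_braiding t) = m t;
  qcqs_ev_sym : forall t : yd_tensor X X, ev (yd_braiding t) = ev t
}.

Definition yd_conj : ydData :=
  @YDData A (fun a b => \sum_(p <- sw (coprod a)) p.1 * b * antipode p.2)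
    (fun a => coprod a).

Definition conj_mul (t : yd_tensor yd_conj yd_conj) : yd_conj :=
  \sum_(p <- sw t) (p.1 : A) * p.2.

Definition conj_ev (lam : {scalar A}) (t : yd_tensor yd_conj yd_conj) :
    yd_unit :=
  \sum_(p <- sw t) lam ((p.1 : A) * p.2).

Definition conj_coev (lam : {scalar A}) (c : yd_unit) :
    yd_tensor yd_conj yd_conj :=
  (c : k) *: can_elem lam.

End YetterDrinfeld.

Arguments yd_unit {k A}.

(* Main.v *)
Require Import Defs.
From mathcomp Require Import all_boot all_order all_algebra all_field.

Set Implicit Arguments.
Unset Strict Implicit.
Unset Printing Implicit Defensive.

Import GRing.Theory.
Local Open Scope ring_scope.

(** Write a |> b = a_(1) b S(a_(2)) for conjugation, and D for the coproduct.

Everything that concerns the product alone is a cancellation of antipodes.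
For instance (a_(1) |> b) a_(2) = a_(1) b S(a_(2)) a_(3) = a b is quantum
commutativity (ad_braid), and (a_(1) |> b)(a_(2) |> c) = a |> (b c) makes the
product A-linear (ad_mul).  The Yetter-Drinfeld compatibility (sweedler_ad)
moreover needs D(S(a)) = S(a_(2)) \ox S(a_(1)) (sweedler_antipode).

Colinearity of the form is the integral property a_(1) lam(a_(2)) = lam(a) 1
applied to a product.  Its A-linearity is the substantial point: it says that
lam(a |> b) = counit(a) lam(b), and it uses unimodularity as follows.
- The identity S(b_(1)) lam(b_(2) a) = a_(1) lam(b a_(2)) (integral_swap) makes
  the radical { a | lam(A a) = 0 } a left ideal and left coideal on which the
  counit vanishes, so the form is non-degenerate (integral_nondegenerate).
- Hence some L in A represents the counit, lam(b L) = counit(b).  It is a left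
  integral, so a right one, and lam(L) = 1.
- From integral_swap, L_(1) lam(b L_(2)) = S(b); since L is a right integral,
  T(b) := L_(1) lam(L_(2) b) satisfies T(S(b)) = b (antipode_invK).
- By the first formula and non-degeneracy, b = lam(T(L_(1)) b) L_(2).  Inserting
  this in lam(b c) gives lam(b c) = lam(T(T(c)) b), that is
  lam(a b) = lam(b S(S(a))) (lam_twist), and then
  lam(a_(1) b S(a_(2))) = lam(b S(S(a_(1)) a_(2))) = counit(a) lam(b).

The canonical element sum_i beta_i \ox alpha_i inherits its invariance from
the form.  Expanding one leg in the dual bases turns the claim into an identity
of the form: lam((a |> b) c) = lam(b (S(a) |> c)) for linearity (lam_ad_mul),
and integral_swap for colinearity.  The zigzag identities are the expansions
of an element in the two dual bases. *)

(** * Calculus with Sweedler sums *)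

Section Sweedler.
Variable k : fieldType.
Implicit Types U V W X : lmodType k.

(** The body is curried, unlike that of the sum over [sw t], so that rewriting
finds f by matching instead of having to abstract two projections.  The
codomain is only a zmodType in order to include the scalars k themselves. *)
Definition sweedler V W (U : zmodType) (t : tensor V W) (f : V -> W -> U) : U :=
  \sum_(p <- sw t) f p.1 p.2.

Definition bilin V W U (f : V -> W -> U) :=
  (forall y, linear (fun x => f x y)) /\ (forall x, linear (f x)).

Definition trilin V W X U (f : V -> W -> X -> U) :=
  [/\ forall y z, linear (fun x => f x y z), forall x z, linear (fun y => f x y z)
    & forall x y, linear (f x y)].

End Sweedler.

Notation "'\sw_' ( x , y '<-' t ) E" := (sweedler t (fun x y => E))
  (at level 41, E at level 41, x name, y name, t at level 200,
   format "'[' '\sw_' ( x ,  y  '<-'  t ) '/  '  E ']'") : ring_scope.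

Section SweedlerTheory.
Variable k : fieldType.
Implicit Types U V W X : lmodType k.

Lemma bilinP V W U (f : V -> W -> U) : bilin f -> bilinear_for *:%R *:%R f.
Proof. by case=> f1 f2; split=> [y|x]; [apply: f1 | apply: f2]. Qed.

Lemma linear_idfun U : linear (fun x : U => x).
Proof. by []. Qed.

Lemma linear_comp U V W (f : V -> W) (g : U -> V) :
  linear f -> linear g -> linear (fun x => f (g x)).
Proof. by move=> fL gL a u v; rewrite gL fL. Qed.

Lemma linear_app U V W (g : {linear V -> W}) (f : U -> V) :
  linear f -> linear (fun x => g (f x)).
Proof. by move=> fL a x y; rewrite fL linearP. Qed.

Lemma linear_form U V (g : {scalar V}) (f : U -> V) :
  linear f -> linear (fun x => g (f x) : k^o).
Proof. by move=> fL a x y; rewrite fL linearP. Qed.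

Lemma linear_formZ U V W (g : {scalar V}) (f : U -> V) (w : W) :
  linear f -> linear (fun x => g (f x) *: w).
Proof. by move=> fL a x y; rewrite fL linearP scalerDl scalerA. Qed.

Lemma linear_scale U V (c : k) (f : U -> V) :
  linear f -> linear (fun x => c *: f x).
Proof. by move=> fL a x y; rewrite fL scalerDr !scalerA mulrC. Qed.

Lemma linear_mull U (A : falgType k) (f : U -> A) (b : A) :
  linear f -> linear (fun x => f x * b).
Proof. by move=> fL a x y; rewrite fL mulrDl scalerAl. Qed.

Lemma linear_mulr U (A : falgType k) (f : U -> A) (b : A) :
  linear f -> linear (fun x => b * f x).
Proof. by move=> fL a x y; rewrite fL mulrDr scalerAr. Qed.

Lemma linear_purel U V W (f : U -> V) (w : W) :
  linear f -> linear (fun x => f x \ox w).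
Proof. by move=> fL a x y; rewrite fL linearPl. Qed.

Lemma linear_purer U V W (f : U -> W) (v : V) :
  linear f -> linear (fun x => v \ox f x).
Proof. by move=> fL a x y; rewrite fL linearPr. Qed.

Lemma linear_sums U V I (r : seq I) (f : I -> U -> V) :
  (forall i, linear (f i)) -> linear (fun x => \sum_(i <- r) f i x).
Proof.
move=> fL a x y; rewrite scaler_sumr -big_split.
by apply: eq_bigr => i _; apply: fL.
Qed.

Lemma linear_sweedler U V W X (t : tensor V W) (f : V -> W -> U -> X) :
  (forall x y, linear (f x y)) -> linear (fun u => \sw_(x, y <- t) f x y u).
Proof. by move=> fL; apply: linear_sums => p; apply: fL. Qed.

Lemma linear_sweedlert U V W X (t : U -> tensor V W) (f : V -> W -> X) :
  linear t -> bilin f -> linear (fun u => sweedler (t u) f).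
Proof.
move=> tL /bilinP/sum_sw_linear fL a x y.
by rewrite tL; apply: fL.
Qed.

Lemma linear_bilinl U V W X (f : V -> W -> X) (g : U -> V) y :
  bilin f -> linear g -> linear (fun x => f (g x) y).
Proof. by case=> fL _ gL a u v; rewrite gL; apply: fL. Qed.

Lemma linear_bilinr U V W X (f : V -> W -> X) (g : U -> W) x :
  bilin f -> linear g -> linear (fun y => f x (g y)).
Proof. by case=> _ fL gL a u v; rewrite gL; apply: fL. Qed.

Lemma linear_Z U V (f : U -> V) (a : k) x : linear f -> f (a *: x) = a *: f x.
Proof.
move=> fL; have f0 : f 0 = 0.
  by have := fL (-1) 0 0; rewrite scaler0 addr0 scaleN1r addNr.
by have := fL a x 0; rewrite f0 !addr0.
Qed.

Lemma linear_0 U V (f : U -> V) : linear f -> f 0 = 0.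
Proof. by move=> fL; rewrite -(scale0r 0) linear_Z ?scale0r. Qed.

Lemma linear_D U V (f : U -> V) x y : linear f -> f (x + y) = f x + f y.
Proof. by move=> fL; have := fL 1 x y; rewrite !scale1r. Qed.

Lemma linear_sumE U V (f : U -> V) I (r : seq I) (g : I -> U) :
  linear f -> f (\sum_(i <- r) g i) = \sum_(i <- r) f (g i).
Proof.
move=> fL; apply: (big_morph f) => [x y|]; first exact: linear_D.
exact: linear_0.
Qed.

Lemma linear_swE U V W X (f : U -> V) (t : tensor W X) (g : W -> X -> U) :
  linear f -> f (sweedler t g) = \sw_(x, y <- t) f (g x y).
Proof. exact: linear_sumE. Qed.

Lemma scale_sweedler U W X c (t : tensor W X) (g : W -> X -> U) :
  c *: sweedler t g = \sw_(x, y <- t) (c *: g x y).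
Proof. exact: scaler_sumr. Qed.

Lemma eq_sweedler V W (U : zmodType) (t : tensor V W) (f g : V -> W -> U) :
  (forall x y, f x y = g x y) -> sweedler t f = sweedler t g.
Proof. by move=> fg; apply: eq_bigr => p _. Qed.

Lemma exchange_sweedler V W V' W' (U : zmodType)
    (t : tensor V W) (s : tensor V' W') (f : V -> W -> V' -> W' -> U) :
  \sw_(x, y <- t) \sw_(z, w <- s) f x y z w =
  \sw_(z, w <- s) \sw_(x, y <- t) f x y z w.
Proof. exact: exchange_big. Qed.

Lemma sweedler_pure V W U (f : V -> W -> U) x y :
  bilin f -> sweedler (x \ox y) f = f x y.
Proof. by move/bilinP=> fB; apply: sum_sw_pure. Qed.

Lemma sweedler_swE V W V' W' U (t : tensor V' W') (h : V' -> W' -> tensor V W)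
    (f : V -> W -> U) :
  bilin f -> sweedler (sweedler t h) f = \sw_(x, y <- t) sweedler (h x y) f.
Proof.
by move=> fB; apply: (linear_swE t h (linear_sweedlert (@linear_idfun _) fB)).
Qed.

End SweedlerTheory.

(** Sums over a chosen representative of a tensor have a meaning only for
multilinear summands, so every rewriting step below has a linearity side
condition.  This tactic follows the syntax of the summand; at a Sweedler sum it
distinguishes a variable in the summand ([linear_sweedler]) from one in the
tensor summed over ([linear_sweedlert]). *)
Ltac lin :=
  lazymatch goal with
  | |- bilin _ => first [ solve [auto] | split=> ? /=; lin ]
  | |- trilin _ => first [ solve [auto] | split=> ? ? /=; lin ]
  | |- forall _, _ => intro; lin
  | |- _ =>
    cbv beta;
    first [ solve [auto] | exact: linear_idfun | exact: linearP
          | apply: linear_sweedler; lin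
          | apply: linear_sweedlert; lin
          | apply: linear_app; lin
          | apply: linear_form; lin
          | apply: linear_formZ; lin
          | apply: linear_scale; lin
          | apply: linear_mull; lin
          | apply: linear_mulr; lin
          | apply: linear_purel; lin
          | apply: linear_purer; lin
          | match goal with H : bilin _ |- _ => apply: (linear_bilinl _ H); lin end
          | match goal with H : bilin _ |- _ => apply: (linear_bilinr _ H); lin end
          | match goal with H : trilin _ |- _ => case: H => *; solve [auto] end ]
  end.

(** * The antipode and its cancellation rules *)

Section Hopf.
Variables (k : fieldType) (A : hopfAlg k).
Implicit Types (a b : A) (U V : lmodType k).

Local Notation S := (@antipode k A).

Lemma coprodA_sw a :
  \sw_(u, z <- coprod a) \sw_(x, y <- coprod u) x \ox (y \ox z) =
  \sw_(x, u <- coprod a) \sw_(y, z <- coprod u) x \ox (y \ox z).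
Proof. exact: coprodA. Qed.

Lemma coprodM_sw a b :
  coprod (a * b) =
  \sw_(x, y <- coprod a) \sw_(z, w <- coprod b) (x * z) \ox (y * w).
Proof. exact: coprodM. Qed.

Lemma counitl_sw a : \sw_(x, y <- coprod a) (counit x *: y) = a.
Proof. exact: counitl. Qed.

Lemma counitr_sw a : \sw_(x, y <- coprod a) (counit y *: x) = a.
Proof. exact: counitr. Qed.

Lemma antipodel_sw a : \sw_(x, y <- coprod a) (S x * y) = counit a *: 1.
Proof. exact: antipodel. Qed.

Lemma antipoder_sw a : \sw_(x, y <- coprod a) (x * S y) = counit a *: 1.
Proof. exact: antipoder. Qed.

(** The trilinear form of coassociativity: f induces a linear map on
A \ox (A \ox A), to be applied to both sides of the axiom. *)
Lemma coassoc U (f : A -> A -> A -> U) a : trilin f ->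
  \sw_(u, z <- coprod a) \sw_(x, y <- coprod u) f x y z =
  \sw_(x, u <- coprod a) \sw_(y, z <- coprod u) f x y z.
Proof.
move=> fT; have [f1 f2 f3] := fT.
have fB (x : A) : bilin (f x) by split.
pose g (x : A) (t : tensor A A) := sweedler t (f x).
have gB : bilin g by rewrite /g; lin.
have := congr1 (fun t => sweedler t g) (coprodA_sw a).
have pE x y z : sweedler (x \ox (y \ox z)) g = f x y z.
  by rewrite sweedler_pure // /g sweedler_pure.
rewrite !sweedler_swE //.
under eq_sweedler => u z do rewrite sweedler_swE //.
under [RHS]eq_sweedler => u z do rewrite sweedler_swE //.
under eq_sweedler => u z do under eq_sweedler => x y do rewrite pE.
by under [RHS]eq_sweedler => u z do under eq_sweedler => x y do rewrite pE.
Qed.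

Lemma antipode1 : S 1 = 1.
Proof.
have := antipodel_sw 1; rewrite coprod1 sweedler_pure ?mulr1; last by lin.
by rewrite counit1 scale1r.
Qed.

Lemma sweedlerM U (f : A -> A -> U) a b : bilin f ->
  sweedler (coprod (a * b)) f =
  \sw_(x, y <- coprod a) \sw_(z, w <- coprod b) f (x * z) (y * w).
Proof.
move=> fB; rewrite coprodM_sw sweedler_swE //; apply: eq_sweedler => x y.
rewrite sweedler_swE //; apply: eq_sweedler => z w.
exact: sweedler_pure.
Qed.

Lemma sweedler1 U (f : A -> A -> U) : bilin f -> sweedler (coprod 1) f = f 1 1.
Proof. by move=> fB; rewrite coprod1 sweedler_pure. Qed.

Lemma sweedler_counitl U (f : A -> U) a : linear f ->
  \sw_(x, y <- coprod a) (counit x *: f y) = f a.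
Proof.
move=> fL; rewrite -{2}(counitl_sw a) linear_swE //.
by apply: eq_sweedler => x y; rewrite linear_Z.
Qed.

Lemma sweedler_counitr U (f : A -> U) a : linear f ->
  \sw_(x, y <- coprod a) (counit y *: f x) = f a.
Proof.
move=> fL; rewrite -{2}(counitr_sw a) linear_swE //.
by apply: eq_sweedler => x y; rewrite linear_Z.
Qed.

Lemma antipodel_head U (f : A -> A -> U) a : bilin f ->
  \sw_(u, z <- coprod a) \sw_(x, y <- coprod u) f (S x * y) z = f 1 a.
Proof.
move=> [f1 f2]; rewrite -(sweedler_counitl (f := f 1)) //.
apply: eq_sweedler => u z.
rewrite -(linear_swE _ _ (f := fun s => f s z)) // antipodel_sw.
exact: (linear_Z _ _ (f1 z)).
Qed.

Lemma antipoder_head U (f : A -> A -> U) a : bilin f ->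
  \sw_(u, z <- coprod a) \sw_(x, y <- coprod u) f (x * S y) z = f 1 a.
Proof.
move=> [f1 f2]; rewrite -(sweedler_counitl (f := f 1)) //.
apply: eq_sweedler => u z.
rewrite -(linear_swE _ _ (f := fun s => f s z)) // antipoder_sw.
exact: (linear_Z _ _ (f1 z)).
Qed.

Lemma antipoder_tail U (f : A -> A -> U) a : bilin f ->
  \sw_(x, u <- coprod a) \sw_(y, z <- coprod u) f x (y * S z) = f a 1.
Proof.
move=> [f1 f2]; rewrite -(sweedler_counitr (f := f^~ 1)) //.
apply: eq_sweedler => x u.
rewrite -(linear_swE _ _ (f := f x)) // antipoder_sw.
exact: (linear_Z _ _ (f2 x)).
Qed.

Lemma antipodel_tail U (f : A -> A -> U) a : bilin f ->
  \sw_(x, u <- coprod a) \sw_(y, z <- coprod u) f x (S y * z) = f a 1.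
Proof.
move=> [f1 f2]; rewrite -(sweedler_counitr (f := f^~ 1)) //.
apply: eq_sweedler => x u.
rewrite -(linear_swE _ _ (f := f x)) // antipodel_sw.
exact: (linear_Z _ _ (f2 x)).
Qed.

(** Both sides evaluate S(a_(1) b_(1)) a_(2) b_(2) S(b_(3)) S(a_(3)): cancelling
b_(2) S(b_(3)) and then a_(2) S(a_(3)) leaves S(a b), while the first two
factors are S(x_(1)) x_(2) for x = a b. *)
Lemma antipodeM a b : S (a * b) = S b * S a.
Proof.
transitivity (\sw_(u, z <- coprod a) \sw_(x, y <- coprod u)
   \sw_(u', z' <- coprod b) \sw_(x', y' <- coprod u')
      (S (x * x') * (y * (y' * S z') * S z))).
  rewrite coassoc; last by lin.
  transitivity (\sw_(x, u <- coprod a) \sw_(y, z <- coprod u)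
      (S (x * b) * (y * S z))).
    by rewrite (antipoder_tail (f := fun x y => S (x * b) * y)) ?mulr1 //; lin.
  apply: eq_sweedler => x u; apply: eq_sweedler => y z.
  rewrite coassoc; last by lin.
  rewrite (antipoder_tail (f := fun x' w => S (x * x') * (y * w * S z))).
    by rewrite mulr1.
  by lin.
transitivity (\sw_(u, z <- coprod a) \sw_(u', z' <- coprod b)
    ((counit u * counit u') *: (S z' * S z))).
  apply: eq_sweedler => u z; rewrite exchange_sweedler.
  apply: eq_sweedler => u' z'.
  transitivity (\sw_(x, y <- coprod (u * u')) (S x * y * (S z' * S z))).
    rewrite sweedlerM; last by lin.
    by do 2![apply: eq_sweedler => ? ?]; rewrite !mulrA.
  rewrite -(linear_swE _ _ (f := fun s => s * (S z' * S z))); last by lin.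
  by rewrite antipodel_sw -scalerAl mul1r counitM.
transitivity (\sw_(u, z <- coprod a) (counit u *: (S b * S z))).
  apply: eq_sweedler => u z.
  under eq_sweedler => u' z' do rewrite mulrC -scalerA.
  by rewrite (sweedler_counitl (f := fun t => counit u *: (S t * S z))) //; lin.
by rewrite (sweedler_counitl (f := fun t => S b * S t)) //; lin.
Qed.

(** The cancellation a_(1) S(a_(4)) \ox a_(2) S(a_(3)) = counit(a) 1 \ox 1: the
inner pair disappears first and makes the outer one adjacent. *)
Lemma antipoder_nested U (f : A -> A -> U) a : bilin f ->
  \sw_(y, z <- coprod a) \sw_(p, q <- coprod y) \sw_(r, s <- coprod z)
    f (p * S s) (q * S r) = counit a *: f 1 1.
Proof.
move=> fB; rewrite coassoc; last by lin.
transitivity (\sw_(p, u <- coprod a) f (p * S u) 1).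
  apply: eq_sweedler => p u.
  rewrite -(coassoc (f := fun q r s => f (p * S s) (q * S r))); last by lin.
  by rewrite (antipoder_head (f := fun t s => f (p * S s) t)) //; lin.
case: fB => f1 f2.
rewrite -(linear_swE _ _ (f := f^~ 1)) // antipoder_sw.
exact: (linear_Z _ _ (f1 1)).
Qed.

(** The antipode reverses the coproduct, for the same reason as [antipodeM]:
evaluate D(S(a_(1))) D(a_(2)) (S(a_(4)) \ox S(a_(3))) by cancelling either the
last two factors or the first two. *)
Lemma sweedler_antipode U (f : A -> A -> U) a : bilin f ->
  sweedler (coprod (S a)) f = \sw_(x, y <- coprod a) f (S y) (S x).
Proof.
move=> fB; have [f1 f2] := fB.
transitivity (\sw_(x, v <- coprod a) \sw_(p, q <- coprod (S x))
  \sw_(y, z <- coprod v) \sw_(c, d <- coprod y) \sw_(r, s <- coprod z)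
    f (p * (c * S s)) (q * (d * S r))).
  rewrite -(sweedler_counitr (f := fun x => sweedler (coprod (S x)) f)); last by lin.
  apply: eq_sweedler => x v.
  rewrite scale_sweedler.
  apply: eq_sweedler => p q.
  rewrite (antipoder_nested _ (f := fun t u => f (p * t) (q * u))) ?mulr1 //; lin.
transitivity (\sw_(u, z <- coprod a) \sw_(x, y <- coprod u)
  \sw_(p, q <- coprod (S x)) \sw_(c, d <- coprod y) \sw_(r, s <- coprod z)
    f (p * c * S s) (q * d * S r)).
  rewrite coassoc; last by lin.
  apply: eq_sweedler => x v; rewrite exchange_sweedler.
  by do 4![apply: eq_sweedler => ? ?]; rewrite !mulrA.
rewrite -(sweedler_counitl (f := fun z => \sw_(r, s <- coprod z) f (S s) (S r)));
  last by lin.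
apply: eq_sweedler => u z.
pose F t v := \sw_(r, s <- coprod z) f (t * S s) (v * S r).
have FB : bilin F by rewrite /F; lin.
transitivity (\sw_(x, y <- coprod u) sweedler (coprod (S x * y)) F).
  by apply: eq_sweedler => x y; rewrite sweedlerM.
rewrite -(linear_swE _ _ (f := fun t => sweedler (coprod t) F)); last by lin.
rewrite antipodel_sw (linear_Z (f := fun t => sweedler (coprod t) F)); last by lin.
rewrite sweedler1 //; congr (_ *: _).
by apply: eq_sweedler => r s; rewrite !mul1r.
Qed.

(** * The conjugation action *)

Definition ad a b : A := \sw_(x, y <- coprod a) (x * b * S y).

Lemma ad_bilin : bilin ad.
Proof. by rewrite /ad; lin. Qed.

Lemma ad_1 b : ad 1 b = b.
Proof.
by rewrite /ad sweedler1 ?antipode1 ?mul1r ?mulr1 //; lin.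
Qed.

Lemma ad_actM a b c : ad (a * b) c = ad a (ad b c).
Proof.
rewrite /ad sweedlerM; last by lin.
apply: eq_sweedler => x y.
rewrite (linear_swE _ _ (f := fun t => x * t * S y)); last by lin.
by apply: eq_sweedler => z w; rewrite antipodeM !mulrA.
Qed.

(** A is a module algebra: a_(1) b S(a_(2)) a_(3) c S(a_(4)) loses its middle
antipode. *)
Lemma ad_mul a b c : \sw_(x, y <- coprod a) (ad x b * ad y c) = ad a (b * c).
Proof.
transitivity (\sw_(x, v <- coprod a) \sw_(y, w <- coprod v)
    (x * b * (S y * ad w c))).
  rewrite -coassoc; last by rewrite /ad; lin.
  apply: eq_sweedler => u z.
  rewrite /ad (linear_swE _ _ (f := fun t => t * ad z c)); last by lin.
  by apply: eq_sweedler => x y; rewrite !mulrA.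
transitivity (\sw_(x, v <- coprod a) (x * b * (c * S v))).
  apply: eq_sweedler => x v.
  transitivity (\sw_(y, w <- coprod v) \sw_(z, t <- coprod w)
     (x * b * ((S y * z) * c * S t))).
    apply: eq_sweedler => y w.
    rewrite /ad (linear_swE _ _ (f := fun t => x * b * (S y * t))); last by lin.
    by apply: eq_sweedler => z t; rewrite !mulrA.
  rewrite -(coassoc (f := fun y z t => x * b * ((S y * z) * c * S t))); last by lin.
  rewrite (antipodel_head (f := fun s t => x * b * (s * c * S t))) ?mul1r //; lin.
by rewrite /ad; apply: eq_sweedler => x v; rewrite !mulrA.
Qed.

(** Quantum commutativity, because the braiding of A with itself is
a \ox b |-> (a_(1) |> b) \ox a_(2). *)
Lemma ad_braid a b : \sw_(x, y <- coprod a) (ad x b * y) = a * b.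
Proof.
transitivity (\sw_(x, u <- coprod a) \sw_(y, z <- coprod u) (x * b * (S y * z))).
  rewrite -coassoc; last by lin.
  apply: eq_sweedler => u z.
  rewrite /ad (linear_swE _ _ (f := fun t => t * z)); last by lin.
  by apply: eq_sweedler => x y; rewrite !mulrA.
by rewrite (antipodel_tail (f := fun x y => x * b * y)) ?mulr1 //; lin.
Qed.

(** The Yetter-Drinfeld compatibility: both sides are
a_(1) b_(1) S(a_(4)) \ox a_(2) b_(2) S(a_(3)), with the four factors of a
bracketed as (12)(34) on the left and as ((1(23))4) on the right. *)
Lemma sweedler_ad U (f : A -> A -> U) a b : bilin f ->
  sweedler (coprod (ad a b)) f =
  \sw_(u, z <- coprod a) \sw_(x, y <- coprod u) \sw_(p, q <- coprod b)
    f (x * p * S z) (ad y q).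
Proof.
move=> fB; have [f1 f2] := fB.
transitivity (\sw_(u, v <- coprod a) \sw_(x, y <- coprod u)
    \sw_(z, w <- coprod v) \sw_(p, q <- coprod b)
      f (x * p * S w) (y * q * S z)).
  rewrite /ad (linear_swE _ _ (f := fun t => sweedler (coprod t) f)); last by lin.
  apply: eq_sweedler => u v.
  rewrite sweedlerM // sweedlerM; last by lin.
  apply: eq_sweedler => x y; rewrite [RHS]exchange_sweedler.
  apply: eq_sweedler => p q.
  by rewrite (sweedler_antipode (f := fun z w => f (x * p * z) (y * q * w))) //; lin.
rewrite coassoc; last by lin.
rewrite [RHS]coassoc; last by rewrite /ad; lin.
apply: eq_sweedler => x v.
rewrite -(coassoc (f := fun y z w => \sw_(p, q <- coprod b)
      f (x * p * S w) (y * q * S z))); last by lin.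
apply: eq_sweedler => u w; rewrite exchange_sweedler; apply: eq_sweedler => p q.
by rewrite /ad (linear_swE _ _ (f := f _)).
Qed.

End Hopf.

(** * Structural maps on elementary tensors *)

Section TensorMaps.
Variable k : fieldType.
Implicit Types U V W X : lmodType k.

Lemma tensor_ext_pure V W U (f g : tensor V W -> U) : linear f -> linear g ->
  (forall x y, f (x \ox y) = g (x \ox y)) -> forall t, f t = g t.
Proof.
move=> fL gL fg t; rewrite (swE t) !linear_sumE //.
by apply: eq_bigr => p _.
Qed.

Lemma tmap_lin V V' W W' (f : V -> V') (g : W -> W') :
  linear f -> linear g -> linear (tmap f g).
Proof.
move=> fL gL; apply: (linear_sweedlert (t := id) (f := fun x y => f x \ox g y)).
  exact: linear_idfun.
by split=> x; [apply: linear_purel | apply: linear_purer].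
Qed.

Lemma tmap_pure V V' W W' (f : V -> V') (g : W -> W') x y :
  linear f -> linear g -> tmap f g (x \ox y) = f x \ox g y.
Proof.
move=> fL gL; apply: (sweedler_pure (f := fun x y => f x \ox g y)).
by split=> z; [apply: linear_purel | apply: linear_purer].
Qed.

Lemma tassoc_bilin U V W :
  bilin (fun (t : tensor U V) (w : W) => \sw_(u, v <- t) u \ox (v \ox w)).
Proof. by lin. Qed.

Lemma tassoc_lin U V W : linear (@tassoc k U V W).
Proof.
exact: (linear_sweedlert (t := id) (@linear_idfun _ _) (@tassoc_bilin U V W)).
Qed.

Lemma tassoc_pure U V W (u : U) (v : V) (w : W) :
  tassoc ((u \ox v) \ox w) = u \ox (v \ox w).
Proof.
transitivity (\sw_(x, y <- u \ox v) x \ox (y \ox w)).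
  exact: (sweedler_pure (u \ox v) w (@tassoc_bilin U V W)).
by rewrite sweedler_pure //; lin.
Qed.

Lemma tassoc_inv_bilin U V W :
  bilin (fun (u : U) (t : tensor V W) => \sw_(v, w <- t) (u \ox v) \ox w).
Proof. by lin. Qed.

Lemma tassoc_inv_lin U V W : linear (@tassoc_inv k U V W).
Proof.
exact: (linear_sweedlert (t := id) (@linear_idfun _ _) (@tassoc_inv_bilin U V W)).
Qed.

Lemma tassoc_inv_pure U V W (u : U) (v : V) (w : W) :
  tassoc_inv (u \ox (v \ox w)) = (u \ox v) \ox w.
Proof.
transitivity (\sw_(x, y <- v \ox w) (u \ox x) \ox y).
  exact: (sweedler_pure u (v \ox w) (@tassoc_inv_bilin U V W)).
by rewrite sweedler_pure //; lin.
Qed.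

Lemma tlunit_lin V : linear (@tlunit k V).
Proof.
apply: (linear_sweedlert (t := id) (f := fun (c : k^o) (v : V) => (c : k) *: v)).
  exact: linear_idfun.
split=> x /=; last exact: linear_scale (@linear_idfun _ _).
by move=> a u v; rewrite scalerDl scalerA.
Qed.

Lemma tlunit_pure V (c : k^o) (v : V) : tlunit (c \ox v) = (c : k) *: v.
Proof.
apply: (sweedler_pure (f := fun (c : k^o) (v : V) => (c : k) *: v)).
split=> x /=; last exact: linear_scale (@linear_idfun _ _).
by move=> a u w; rewrite scalerDl scalerA.
Qed.

Lemma trunit_lin V : linear (@trunit k V).
Proof.
apply: (linear_sweedlert (t := id) (f := fun (v : V) (c : k^o) => (c : k) *: v)).
  exact: linear_idfun.
split=> x /=; first exact: linear_scale (@linear_idfun _ _).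
by move=> a u v; rewrite scalerDl scalerA.
Qed.

Lemma trunit_pure V (c : k^o) (v : V) : trunit (v \ox c) = (c : k) *: v.
Proof.
apply: (sweedler_pure (f := fun (v : V) (c : k^o) => (c : k) *: v)).
split=> x /=; first exact: linear_scale (@linear_idfun _ _).
by move=> a u w; rewrite scalerDl scalerA.
Qed.

End TensorMaps.

(** * Multiplication in the conjugation module *)

Section Conj.
Variables (k : fieldType) (A : hopfAlg k).
Implicit Types (a b c : A) (U V W : lmodType k).

Lemma conj_is_yd : is_yd (yd_conj A).
Proof.
split.
- exact/bilinP/ad_bilin.
- by move=> x; apply: (ad_1 (x : A)).
- by move=> a b x; apply: (ad_actM a b (x : A)).
- by move=> c x y; apply: linearP.
- exact: coprodA.
- exact: counitl.
- move=> a x; transitivity (\sw_(y, z <- coprod (ad a x)) (y \ox z)).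
    exact: swE.
  rewrite sweedler_ad //; by lin.
Qed.

(** [tens_act], [tens_coact] and [tens_braid] are the action, the coaction and
the braiding of the tensor square of [yd_conj A], on the bare carrier
[tensor A A], where the linear structure is visible to type inference. *)
Definition tens_act (a : A) (t : tensor A A) : tensor A A :=
  \sw_(x, y <- coprod a) \sw_(u, v <- t) ad x u \ox ad y v.

Definition tens_coact (t : tensor A A) : tensor A (tensor A A) :=
  \sw_(u, v <- t) \sw_(x, y <- coprod u) \sw_(z, w <- coprod v)
    (x * z) \ox (y \ox w).

Lemma ad_tens_bilin (x y : A) : bilin (fun u v => ad x u \ox ad y v).
Proof. by rewrite /ad; lin. Qed.

Lemma tens_act_lin a : linear (tens_act a).
Proof.
apply: linear_sweedler => x y.
exact: (linear_sweedlert (@linear_idfun _ _) (ad_tens_bilin x y)).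
Qed.

Lemma tens_act_pure a (u v : A) :
  tens_act a (u \ox v) = \sw_(x, y <- coprod a) ad x u \ox ad y v.
Proof.
by apply: eq_sweedler => x y; apply: sweedler_pure (ad_tens_bilin x y).
Qed.

Lemma coact_tens_bilin : bilin (fun u v : A =>
  \sw_(x, y <- coprod u) \sw_(z, w <- coprod v) (x * z) \ox (y \ox w)).
Proof. by lin. Qed.

Lemma tens_coact_lin : linear tens_coact.
Proof. exact: (linear_sweedlert (@linear_idfun _ _) coact_tens_bilin). Qed.

Lemma tens_coact_pure (u v : A) : tens_coact (u \ox v) =
  \sw_(x, y <- coprod u) \sw_(z, w <- coprod v) (x * z) \ox (y \ox w).
Proof. exact: (sweedler_pure _ _ coact_tens_bilin). Qed.

Lemma mul_bilin : bilin (fun u v : A => u * v).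
Proof. by lin. Qed.

Local Notation m := (@conj_mul k A : tensor A A -> A).

Lemma conj_mul_lin : linear m.
Proof. exact: (linear_sweedlert (@linear_idfun _ _) mul_bilin). Qed.

Lemma conj_mul_pure (u v : A) : m (u \ox v) = u * v.
Proof. exact: sweedler_pure mul_bilin. Qed.

Lemma ad_linr a : linear (ad a).
Proof. exact: (proj2 (ad_bilin A)). Qed.

Lemma conj_mul_act a (t : tensor A A) : m (tens_act a t) = ad a (m t).
Proof.
move: t; apply: tensor_ext_pure => [||u v].
- exact: linear_comp conj_mul_lin (tens_act_lin a).
- exact: linear_comp (ad_linr a) conj_mul_lin.
rewrite tens_act_pure conj_mul_pure -ad_mul linear_swE; last exact: conj_mul_lin.
by apply: eq_sweedler => x y; rewrite conj_mul_pure.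
Qed.

Lemma conj_mul_coact (t : tensor A A) :
  coprod (m t) = tmap id m (tens_coact t).
Proof.
have tL := tmap_lin (@linear_idfun _ A) conj_mul_lin.
move: t; apply: tensor_ext_pure => [||u v].
- exact: linear_comp (@linearP _ _ _ _ coprod) conj_mul_lin.
- exact: linear_comp tL tens_coact_lin.
rewrite tens_coact_pure conj_mul_pure coprodM_sw linear_swE //.
apply: eq_sweedler => x y; rewrite linear_swE //.
apply: eq_sweedler => z w; rewrite tmap_pure ?conj_mul_pure //; exact: conj_mul_lin.
Qed.

Lemma conj_mul_morphism : yd_morphism (@conj_mul k A).
Proof. by split; [exact: conj_mul_lin|exact: conj_mul_act|exact: conj_mul_coact]. Qed.

Definition tens_braid (t : tensor A A) : tensor A A :=
  \sw_(u, v <- t) \sw_(x, y <- coprod u) ad x v \ox y.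

Lemma braid_bilin :
  bilin (fun u v : A => \sw_(x, y <- coprod u) ad x v \ox y).
Proof. by rewrite /ad; lin. Qed.

Lemma conj_mul_braid (t : tensor A A) : m (tens_braid t) = m t.
Proof.
move: t; apply: tensor_ext_pure => [||u v].
- apply: linear_comp conj_mul_lin _.
  exact: (linear_sweedlert (@linear_idfun _ _) braid_bilin).
- exact: conj_mul_lin.
rewrite /tens_braid (sweedler_pure _ _ braid_bilin).
rewrite (linear_swE _ _ conj_mul_lin) conj_mul_pure -ad_braid.
by apply: eq_sweedler => x y; rewrite conj_mul_pure.
Qed.

Lemma conj_mul_assoc (t : tensor (tensor A A) A) :
  m (tmap m id t) = m (tmap id m (tassoc t)).
Proof.
have mL := conj_mul_lin; have iL := @linear_idfun _ A.
move: t; apply: tensor_ext_pure => [||s w].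
- exact: linear_comp mL (tmap_lin mL iL).
- exact: linear_comp mL (linear_comp (tmap_lin iL mL) (@tassoc_lin k A A A)).
move: s; apply: tensor_ext_pure => [||u v].
- apply: linear_comp mL (linear_comp (tmap_lin mL iL) _); exact: linear_purel.
- apply: linear_comp mL (linear_comp (tmap_lin iL mL) (linear_comp (@tassoc_lin k A A A) _)).
  exact: linear_purel.
by rewrite tassoc_pure !tmap_pure // !conj_mul_pure mulrA.
Qed.

End Conj.

(** * Non-degeneracy of the integral *)

Section Integral.
Variables (k : fieldType) (A : hopfAlg k) (lam : {scalar A}).
Hypothesis lam_int : dual_left_integral lam.
Implicit Types (a b : A) (U V : lmodType k).

Local Notation S := (@antipode k A).

Lemma scalar_ext a b : (forall f : {scalar A}, f a = f b) -> a = b.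
Proof.
move=> ab; rewrite (coord_vbasis (memvf a)) (coord_vbasis (memvf b)).
by apply: eq_bigr => i _; rewrite ab.
Qed.

(** An identity in A follows from its images under all functionals f, and those
are the convolution identities f * lam = f(1) lam. *)
Lemma integralE a : \sw_(x, y <- coprod a) (lam y *: x) = lam a *: 1.
Proof.
apply: scalar_ext => f; rewrite linearZ /= mulrC -[RHS](lam_int f).
by rewrite linear_sum; apply: eq_bigr => p _; rewrite linearZ mulrC.
Qed.

(** Both sides equal S(b_(1)) b_(2) a_(1) lam(b_(3) a_(2)): apply the integral
property to b_(2) a, or cancel S(b_(1)) b_(2). *)
Lemma integral_swap a b :
  \sw_(x, y <- coprod b) (lam (y * a) *: S x) =
  \sw_(x, y <- coprod a) (lam (b * y) *: x).
Proof.
transitivity (\sw_(x, u <- coprod b) \sw_(y, z <- coprod u)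
    \sw_(c, d <- coprod a) (lam (z * d) *: (S x * y * c))).
  apply: eq_sweedler => x u.
  transitivity (S x * \sw_(y, z <- coprod (u * a)) (lam z *: y)).
    by rewrite integralE -scalerAr mulr1.
  rewrite sweedlerM; last by lin.
  rewrite (linear_swE _ _ (f := fun t => S x * t)); last by lin.
  apply: eq_sweedler => y z.
  rewrite (linear_swE _ _ (f := fun t => S x * t)); last by lin.
  by apply: eq_sweedler => c d; rewrite -scalerAr mulrA.
rewrite -coassoc; last by lin.
rewrite (antipodel_head (f := fun t z => \sw_(c, d <- coprod a) (lam (z * d) *: (t * c)))).
  by apply: eq_sweedler => c d; rewrite mul1r.
by lin.
Qed.

Lemma integral_radical_coprod a c :
  (forall b, lam (b * a) = 0) -> \sw_(x, y <- coprod a) (lam (c * y) *: x) = 0.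
Proof.
move=> a0; rewrite -integral_swap.
by apply: big1 => p _; rewrite a0 scale0r.
Qed.

Hypothesis lam_neq0 : exists a : A, lam a != 0.

(** The second leg of D(a) lies in the radical, which is a left ideal, so
counit(a) lam(b) = lam(b S(a_(1)) a_(2)) = 0. *)
Lemma integral_radical_counit a :
  (forall b, lam (b * a) = 0) -> counit a = 0.
Proof.
move=> a0; have [b lamb] := lam_neq0.
suff: counit a * lam b = 0 by move/eqP; rewrite mulf_eq0 (negPf lamb) orbF => /eqP.
have zero c := integral_radical_coprod c a0.
transitivity (lam (b * (counit a *: 1))); first by rewrite -scalerAr mulr1 linearZ.
rewrite -antipodel_sw.
rewrite (linear_swE (V := k^o) _ _ (f := fun t => lam (b * t))); last by lin.
(* Expanding b S(x) in a basis e separates x from y: the sum over D(a) becomes a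
   value of x |-> coord e i (b S(x)) at the vanishing element
   lam(e_i a_(2)) a_(1). *)
pose e := vbasis {:A}.
transitivity (\sw_(x, y <- coprod a) (\sum_i coord e i (b * S x) * lam (e`_i * y) : k^o)).
  apply: eq_sweedler => x y.
  rewrite mulrA {1}(coord_vbasis (memvf (b * S x))) mulr_suml linear_sum.
  by apply: eq_bigr => i _; rewrite -scalerAl linearZ.
rewrite /sweedler exchange_big big1 // => i _.
transitivity (coord e i (b * S (\sw_(x, y <- coprod a) (lam (e`_i * y) *: x)))).
  rewrite (linear_swE (V := k^o) _ _ (f := fun t => coord e i (b * S t))); last by lin.
  apply: eq_bigr => p _; rewrite linearZ /= -scalerAr linearZ /= mulrC //.
by rewrite zero !linear0 mulr0 linear0.
Qed.

(** For a in the radical and f a functional, f(a_(1)) a_(2) is again in the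
radical, so its counit, which is f(a), vanishes. *)
Lemma integral_nondegenerate a : (forall b, lam (b * a) = 0) -> a = 0.
Proof.
move=> a0.
have zero c := integral_radical_coprod c a0.
apply: scalar_ext => f; rewrite linear0.
transitivity (counit (\sw_(x, y <- coprod a) (f x *: y))).
  rewrite -{1}(counitr_sw a).
  rewrite (linear_swE (V := k^o) _ _ (f := fun t => f t)); last by lin.
  rewrite (linear_swE (V := k^o) _ _ (f := fun t => counit t)); last by lin.
  by apply: eq_sweedler => x y; rewrite !linearZ /= mulrC.
apply: integral_radical_counit => c.
rewrite (linear_swE (V := k^o) _ _ (f := fun t => lam (c * t))); last by lin.
rewrite -[RHS](linear0 f) -(zero c).
rewrite (linear_swE (V := k^o) _ _ (f := fun t => f t)); last by lin.
by apply: eq_sweedler => x y; rewrite -scalerAr !linearZ /= mulrC.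
Qed.

Let al := @can_alpha k A.
Let be := @can_beta k A lam.

Lemma lam_alpha_beta i j : lam (al i * be j) = (i == j)%:R.
Proof. exact: can_pairing (nondegenerate_gram integral_nondegenerate) i j. Qed.

Lemma beta_expand a : a = \sum_i lam (al i * a) *: be i.
Proof.
apply/eqP; rewrite -subr_eq0; apply/eqP; apply: integral_nondegenerate => b.
rewrite [b]can_alpha_expand mulr_suml linear_sum big1 // => i _.
rewrite -scalerAl linearZ /= mulrBr linearB /= mulr_sumr linear_sum (bigD1 i) //=.
rewrite -scalerAr linearZ /= lam_alpha_beta eqxx mulr1 big1 ?addr0 ?subrr ?mulr0 //.
by move=> j ij; rewrite -scalerAr linearZ /= lam_alpha_beta eq_sym (negPf ij) mulr0.
Qed.

Lemma alpha_expand a : a = \sum_i lam (a * be i) *: al i.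
Proof.
rewrite {1}[a]can_alpha_expand; apply: eq_bigr => i _; congr (_ *: _).
rewrite {2}[a]can_alpha_expand mulr_suml linear_sum (bigD1 i) //=.
rewrite -scalerAl linearZ /= lam_alpha_beta eqxx mulr1 big1 ?addr0 //.
by move=> j ij; rewrite -scalerAl linearZ /= lam_alpha_beta (negPf ij) mulr0.
Qed.

(** The element L that represents the counit through the form. *)
Definition cointegral : A := \sum_i counit (al i) *: be i.
Local Notation La := cointegral.

Lemma lam_cointegral b : lam (b * La) = counit b.
Proof.
rewrite {2}[b]alpha_expand mulr_sumr !linear_sum.
by apply: eq_bigr => i _; rewrite -scalerAr !linearZ /= mulrC.
Qed.

Lemma cointegral_left : left_integral La.
Proof.
move=> a; apply/eqP; rewrite -subr_eq0; apply/eqP.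
apply: integral_nondegenerate => b; rewrite mulrBr linearB /= mulrA.
by rewrite -scalerAr linearZ /= !lam_cointegral counitM mulrC subrr.
Qed.

Lemma antipode_cointegral b : \sw_(x, y <- coprod La) (lam (b * y) *: x) = S b.
Proof.
rewrite -integral_swap.
under eq_sweedler => x y do rewrite lam_cointegral.
by apply: sweedler_counitr; lin.
Qed.

(** * Unimodularity and invariance of the integral *)

Section Unimodular.
Hypothesis unimodA : unimodular A.

Lemma cointegral_right : right_integral La.
Proof. exact/unimodA/cointegral_left. Qed.

(** L_(1) b \ox L_(2) = L_(1) b_(1) \ox L_(2) b_(2) S(b_(3)), where D(L b_(1))
is counit(b_(1)) D(L) because L is a right integral. *)
Lemma cointegral_swap U (f : A -> A -> U) b : bilin f ->
  \sw_(x, y <- coprod La) f (x * b) y = \sw_(x, y <- coprod La) f x (y * S b).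
Proof.
move=> fB; have [f1 f2] := fB.
transitivity (\sw_(u, w <- coprod b) \sw_(z, t <- coprod u)
    \sw_(x, y <- coprod La) f (x * z) (y * (t * S w))).
  rewrite coassoc; last by lin.
  rewrite (antipoder_tail (f := fun z t => \sw_(x, y <- coprod La) f (x * z) (y * t))).
    by apply: eq_sweedler => x y; rewrite mulr1.
  by lin.
pose F w t v := f t (v * S w).
have FB w : bilin (F w) by rewrite /F; lin.
transitivity (\sw_(u, w <- coprod b) (counit u *: sweedler (coprod La) (F w))).
  apply: eq_sweedler => u w; rewrite exchange_sweedler.
  transitivity (sweedler (coprod (La * u)) (F w)).
    rewrite (sweedlerM La u (FB w)).
    by do 2![apply: eq_sweedler => ? ?]; rewrite /F mulrA.
  rewrite cointegral_right.
  by apply: (linear_Z (f := fun t => sweedler (coprod t) (F w))); lin.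
rewrite (sweedler_counitl (f := fun w => sweedler (coprod La) (F w))) //.
by rewrite /F; lin.
Qed.

Definition antipode_inv b : A := \sw_(x, y <- coprod La) (lam (y * b) *: x).
Local Notation T := antipode_inv.

Lemma antipode_inv_lin : linear T.
Proof. by rewrite /T; lin. Qed.

Lemma antipode_invK b : T (S b) = b.
Proof.
rewrite /T -(cointegral_swap (f := fun x y => lam y *: x)); last by lin.
transitivity ((\sw_(x, y <- coprod La) (lam y *: x)) * b).
  rewrite (linear_swE _ _ (f := fun t => t * b)); last by lin.
  by apply: eq_sweedler => x y; rewrite scalerAl.
rewrite integralE -[La]mul1r lam_cointegral counit1 scale1r mul1r //.
Qed.

(** A reconstruction formula: pairing the left side with c gives
lam(T(L_(1) lam(c L_(2))) b) = lam(T(S(c)) b) = lam(c b), and the form is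
non-degenerate. *)
Lemma cointegral_dual_basis b :
  \sw_(x, y <- coprod La) (lam (T x * b) *: y) = b.
Proof.
apply/eqP; rewrite -subr_eq0; apply/eqP.
apply: integral_nondegenerate => c; rewrite mulrBr linearB /=.
rewrite -{2}(antipode_invK c) -antipode_cointegral.
have TL := antipode_inv_lin.
rewrite (linear_swE (V := k^o) _ _ (f := fun t => lam (T t * b))); last first.
  apply: linear_form; apply: linear_mull; exact: TL.
rewrite (linear_swE (V := k^o) _ _ (f := fun t => lam (c * t))); last by lin.
apply/eqP; rewrite subr_eq0; apply/eqP; apply: eq_sweedler => x y.
by rewrite (linear_Z _ _ TL) -scalerAl -scalerAr !linearZ /= mulrC.
Qed.

(** Replace b by lam(T(L_(1)) b) L_(2) in lam(b c) and recognise
T(c) = L_(1) lam(L_(2) c). *)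
Lemma lam_antipode_inv2 b c : lam (T (T c) * b) = lam (b * c).
Proof.
rewrite -{2}(cointegral_dual_basis b) {1}/T.
have TL := antipode_inv_lin.
rewrite (linear_swE (V := k^o) _ _ (f := fun t => lam (t * c))); last by lin.
rewrite (linear_swE (V := k^o) _ _ (f := fun t => lam (T t * b))); last first.
  apply: linear_form; apply: linear_mull; exact: TL.
apply: eq_sweedler => x y.
by rewrite (linear_Z _ _ TL) -!scalerAl !linearZ /= mulrC.
Qed.

(** The Nakayama automorphism of the form is the square of the antipode; this is
where unimodularity acts. *)
Lemma lam_twist a b : lam (a * b) = lam (b * S (S a)).
Proof. by rewrite -(lam_antipode_inv2 b) !antipode_invK. Qed.

Lemma lam_ad a b : lam (ad a b) = counit a * lam b.
Proof.
rewrite /ad (linear_swE (V := k^o) _ _ (f := fun t => lam t)); last by lin.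
transitivity (lam (b * S (\sw_(x, y <- coprod a) (S x * y)))).
  rewrite (linear_swE (V := k^o) _ _ (f := fun t => lam (b * S t))); last by lin.
  by apply: eq_sweedler => x y; rewrite -mulrA (lam_twist x) -mulrA -antipodeM.
by rewrite antipodel_sw linearZ /= antipode1 -scalerAr mulr1 linearZ.
Qed.

(** * The form and the canonical element as morphisms *)

Local Notation ev := (conj_ev lam : tensor A A -> k^o).
Local Notation m := (@conj_mul k A : tensor A A -> A).

Lemma conj_evE (t : tensor A A) : ev t = lam (m t).
Proof. by rewrite linear_sum. Qed.

Lemma conj_ev_lin : linear ev.
Proof. by move=> a s t; rewrite !conj_evE conj_mul_lin linearP. Qed.

Lemma conj_ev_pure (u v : A) : ev (u \ox v) = lam (u * v).
Proof. by rewrite conj_evE conj_mul_pure. Qed.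

Lemma conj_ev_act a (t : tensor A A) : ev (tens_act a t) = counit a * ev t.
Proof. by rewrite !conj_evE conj_mul_act lam_ad. Qed.

(** The form is lam after the product, the product is colinear, and lam is
colinear from (A, D) to the unit object exactly because it is an integral. *)
Lemma conj_ev_coact (t : tensor A A) :
  1 \ox ev t = tmap id ev (tens_coact t).
Proof.
transitivity (tmap id (lam : A -> k^o) (coprod (m t))).
  transitivity ((lam (m t) *: 1 : A) \ox (1 : k^o)).
    rewrite conj_evE linearZl_LR -linearZr_LR /=.
    by congr (_ \ox _); rewrite /GRing.scale /= mulr1.
  rewrite -integralE.
  rewrite (linear_swE _ _ (f := fun x => x \ox (1 : k^o))); last by lin.
  apply: eq_bigr => p _; rewrite linearZl_LR -linearZr_LR /=.
  by congr (_ \ox _); rewrite /GRing.scale /= mulr1.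
rewrite conj_mul_coact.
have lL : linear (lam : A -> k^o) := linear_form lam (@linear_idfun k A).
have mL := @conj_mul_lin k A; have iL := @linear_idfun _ A.
apply: (@tensor_ext_pure k A (tensor A A) (tensor A k^o)
  (fun s => tmap id (lam : A -> k^o) (tmap id m s)) (tmap id ev)) => [||u s].
- exact: linear_comp (tmap_lin iL lL) (tmap_lin iL mL).
- exact: tmap_lin iL conj_ev_lin.
by rewrite !tmap_pure ?conj_evE //; exact: conj_ev_lin.
Qed.

Lemma conj_ev_morphism : yd_morphism (conj_ev lam).
Proof. by split; [exact: conj_ev_lin|exact: conj_ev_act|exact: conj_ev_coact]. Qed.

(** The usual trick that moves an action across a product: by [ad_mul] the left
side is (a_(1) |> b) (a_(2) S(a_(3)) |> c). *)
Lemma ad_antipode a b c :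
  \sw_(x, y <- coprod a) ad x (b * ad (S y) c) = ad a b * c.
Proof.
have [ad1 ad2] := ad_bilin A.
transitivity (\sw_(x, u <- coprod a) \sw_(y, z <- coprod u)
     (ad x b * ad (y * S z) c)).
  rewrite -coassoc; last by rewrite /ad; lin.
  apply: eq_sweedler => u z; rewrite -ad_mul; apply: eq_sweedler => x y.
  by rewrite ad_actM.
rewrite (antipoder_tail (f := fun x u => ad x b * ad u c)) ?ad_1 //.
by rewrite /ad; lin.
Qed.

Lemma lam_ad_mul a b c : lam (ad a b * c) = lam (b * ad (S a) c).
Proof.
rewrite -ad_antipode (linear_swE (V := k^o) _ _ (f := fun t => lam t)); last by lin.
rewrite -(sweedler_counitl (U := k^o) (f := fun y => lam (b * ad (S y) c))).
  by apply: eq_sweedler => x y; rewrite lam_ad.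
by rewrite /ad; lin.
Qed.

(** Each a_(2) |> alpha_i is expanded in the alpha_j, with
coefficients lam((a_(2) |> alpha_i) beta_j) = lam(alpha_i (S(a_(2)) |> beta_j)).
The sum over i then reconstructs S(a_(2)) |> beta_j in the basis beta, and
a_(1) |> S(a_(2)) |> beta_j = counit(a) beta_j. *)
Lemma can_elem_act a : tens_act a (can_elem lam) = counit a *: can_elem lam.
Proof.
rewrite (linear_sumE _ _ (tens_act_lin a)).
transitivity (\sum_j \sw_(x, y <- coprod a) ad x (ad (S y) (be j)) \ox al j).
  transitivity (\sum_i \sum_j \sw_(x, y <- coprod a)
      (lam (al i * ad (S y) (be j)) *: ad x (be i)) \ox al j).
    apply: eq_bigr => i _; rewrite tens_act_pure /sweedler -exchange_big.
    apply: eq_bigr => p _ /=; rewrite {1}[ad _ (can_alpha _)]alpha_expand linear_sumr.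
    by apply: eq_bigr => j _; rewrite lam_ad_mul linearZl_LR linearZr_LR.
  rewrite exchange_big; apply: eq_bigr => j _ /=.
  rewrite /sweedler exchange_big; apply: eq_bigr => p _ /=.
  rewrite -linear_sumlz; congr (_ \ox _).
  rewrite {2}[ad _ (be j)]beta_expand.
  rewrite [RHS](linear_sumE _ _ (ad_linr p.1)); apply: eq_bigr => i _.
  by rewrite (linear_Z _ _ (ad_linr _)).
rewrite scaler_sumr; apply: eq_bigr => j _.
rewrite -(linear_swE _ _ (f := fun t => t \ox al j)); last by lin.
rewrite -linearZl_LR; congr (_ \ox _).
transitivity (ad (\sw_(x, y <- coprod a) (x * S y)) (be j)).
  rewrite (linear_swE _ _ (f := fun t => ad t (be j))).
    by apply: eq_sweedler => x y; rewrite ad_actM.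
  exact: (proj1 (ad_bilin A)).
rewrite antipoder_sw (linear_Z _ _ (proj1 (ad_bilin A) (be j))).
by rewrite ad_1.
Qed.

(** Expand the second leg of D(beta_i) in the beta_j.  By [integral_swap]
its coefficients lam(alpha_j y) move the coproduct from beta_i to alpha_j and
produce an antipode; the sum over i then reconstructs (alpha_j)_(2) in the basis
alpha, and S(alpha_(1)) alpha_(2) \ox alpha_(3) = 1 \ox alpha. *)
Lemma can_elem_coact : tens_coact (can_elem lam) = 1 \ox can_elem lam.
Proof.
rewrite (linear_sumE _ _ (@tens_coact_lin k A)) linear_sumr.
transitivity (\sum_j \sw_(u, v <- coprod (al j)) \sw_(z, w <- coprod v)
    (S u * z) \ox (be j \ox w)).
  transitivity (\sum_i \sum_j \sw_(u, v <- coprod (al j))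
     \sw_(z, w <- coprod (lam (v * be i) *: al i)) (S u * z) \ox (be j \ox w)).
    apply: eq_bigr => i _; rewrite tens_coact_pure.
    transitivity (\sum_j \sw_(x, y <- coprod (be i)) \sw_(z, w <- coprod (al i))
       (lam (al j * y) *: x * z) \ox (be j \ox w)).
      rewrite /sweedler [RHS]exchange_big; apply: eq_bigr => p _ /=.
      rewrite [RHS]exchange_big; apply: eq_bigr => q _ /=.
      rewrite {1}[p.2]beta_expand linear_sumlz linear_sumr; apply: eq_bigr => j _.
      by rewrite !linearZl_LR linearZr_LR -scalerAl linearZl_LR.
    apply: eq_bigr => j _.
    transitivity (\sw_(z, w <- coprod (al i))
        ((\sw_(x, y <- coprod (be i)) (lam (al j * y) *: x)) * z) \ox (be j \ox w)).
      rewrite exchange_sweedler; apply: eq_sweedler => z w.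
      by rewrite (linear_swE _ _ (f := fun t => (t * z) \ox (be j \ox w))) //; lin.
    rewrite -integral_swap.
    transitivity (\sw_(u, v <- coprod (al j)) \sw_(z, w <- coprod (al i))
       (lam (v * be i) *: S u * z) \ox (be j \ox w)).
      rewrite exchange_sweedler; apply: eq_sweedler => z w.
      by rewrite (linear_swE _ _ (f := fun t => (t * z) \ox (be j \ox w))) //; lin.
    apply: eq_sweedler => u v.
    rewrite (linear_Z (f := fun c => \sw_(z, w <- coprod c)
      (S u * z) \ox (be j \ox w))); last by lin.
    rewrite scale_sweedler; apply: eq_sweedler => z w.
    by rewrite -scalerAl linearZl_LR.
  rewrite exchange_big; apply: eq_bigr => j _ /=.
  rewrite /sweedler exchange_big; apply: eq_bigr => p _ /=.
  rewrite {2}[p.2]alpha_expand.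
  rewrite -(linear_sumE _ _ (f := fun c => \sw_(z, w <- coprod c)
      (S p.1 * z) \ox (be j \ox w))) //; lin.
apply: eq_bigr => j _.
rewrite -coassoc; last by lin.
by rewrite (antipodel_head (f := fun z w => z \ox (be j \ox w))) //; lin.
Qed.

Lemma coev_lin : linear (conj_coev lam : k^o -> tensor A A).
Proof. by move=> c x y; rewrite /conj_coev scalerDl scalerA. Qed.

Lemma conj_coev_morphism : yd_morphism (conj_coev lam).
Proof.
split=> [|a c|c]; first exact: coev_lin.
- transitivity (tens_act a ((c : k) *: can_elem lam)); last by [].
  rewrite (linear_Z _ _ (tens_act_lin a)) can_elem_act scalerA mulrC //.
- transitivity (tens_coact ((c : k) *: can_elem lam)); first by [].
  rewrite (linear_Z _ _ (@tens_coact_lin k A)) can_elem_coact.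
  rewrite -linearZr_LR; symmetry.
  exact: (tmap_pure (1 : A) (c : k^o) (@linear_idfun _ A) coev_lin).
Qed.

Lemma zigzagl (x : A) :
  tlunit (tmap ev id (tassoc_inv (tmap id (conj_coev lam : k^o -> tensor A A)
     (x \ox (1 : k^o))))) = x.
Proof.
have eL := conj_ev_lin; have iL := @linear_idfun _ A; have cL := coev_lin.
have fL := tmap_lin eL iL.
rewrite tmap_pure // /conj_coev scale1r linear_sumr.
rewrite (linear_sumE _ _ (@tassoc_inv_lin k A A A)).
rewrite (linear_sumE _ _ fL) (linear_sumE _ _ (@tlunit_lin k A)).
rewrite [RHS]alpha_expand; apply: eq_bigr => i _.
by rewrite tassoc_inv_pure tmap_pure // tlunit_pure conj_ev_pure.
Qed.

Lemma zigzagr (x : A) :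
  trunit (tmap id ev (tassoc (tmap (conj_coev lam : k^o -> tensor A A) id
     ((1 : k^o) \ox x)))) = x.
Proof.
have eL := conj_ev_lin; have iL := @linear_idfun _ A; have cL := coev_lin.
have fL := tmap_lin iL eL.
rewrite tmap_pure // /conj_coev scale1r linear_sumlz.
rewrite (linear_sumE _ _ (@tassoc_lin k A A A)).
rewrite (linear_sumE _ _ fL) (linear_sumE _ _ (@trunit_lin k A)).
rewrite [RHS]beta_expand; apply: eq_bigr => i _.
by rewrite tassoc_pure tmap_pure // trunit_pure conj_ev_pure.
Qed.

End Unimodular.
End Integral.

Theorem proposition15 (k : fieldType) (A : hopfAlg k)
  (unimodA : unimodular A) (lam : {scalar A})
  (lam_integral : dual_left_integral lam)
  (lam_neq0 : exists a : A, lam a != 0) :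
  (yd_morphism (conj_ev lam) /\ yd_morphism (conj_coev lam)) /\
  is_qcqs_algebra (@conj_mul k A) (conj_ev lam) (conj_coev lam).
Proof.
have evM := conj_ev_morphism lam_integral lam_neq0 unimodA.
have coevM := conj_coev_morphism lam_integral lam_neq0 unimodA.
split=> //; split=> //.
- exact: conj_is_yd.
- exact: conj_mul_morphism.
- exact: conj_mul_assoc.
- exact: zigzagl.
- exact: zigzagr.
- by move=> t; rewrite !conj_evE; congr (lam _); apply: conj_mul_assoc.
- exact: conj_mul_braid.
- by move=> t; rewrite !conj_evE; congr (lam _); apply: conj_mul_braid.
Qed.
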